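(* For every integer $n \ge 0$, let $w(n) = n+1$ if $n$ is evil and $w(n) = 0$ if $n$ is odious. Then $w(n) \equiv m(n) \pmod 2$ for all $n \ge 0$.
   Context: For a non-negative integer $k$, $s_2(k)$ denotes the number of ones in the binary expansion of $k$; $k$ is called evil if $s_2(k)$ is even and odious if $s_2(k)$ is odd. Define $\bar{t}(k) = 1$ if $k$ is evil and $\bar{t}(k)=0$ if $k$ is odious. The sequence $m(n)$, $n \ge 0$, is defined by $m(2k) = \bar{t}(k)$ and $m(2k+1) = 0$ for all $k \ge 0$. The sequence $w(n)$ is OEIS A102393, indexed from $n=0$: $1,0,0,4,0,6,7,0,0,10,\ldots$. *)

(* Defs.v *)
From mathcomp Require Import all_boot.

Set Implicit Arguments.
Unset Strict Implicit.
Unset Printing Implicit Defensive.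

(* [odd (k %/ 2 ^ i)] is the i-th binary digit of k; positions i < k suffice
   because k < 2 ^ k. *)
Definition s2 (k : nat) : nat := count (fun i => odd (k %/ 2 ^ i)) (iota 0 k).

Definition evil (k : nat) : bool := ~~ odd (s2 k).
Definition odious (k : nat) : bool := odd (s2 k).

Definition tbar (k : nat) : nat := if evil k then 1 else 0.

Definition m (n : nat) : nat := if odd n then 0 else tbar n./2.

Lemma m_even k : m (2 * k) = tbar k.
Proof. by rewrite /m mul2n odd_double doubleK. Qed.

Lemma m_odd k : m (2 * k + 1) = 0.
Proof. by rewrite /m addn1 mul2n /= odd_double. Qed.

(* OEIS A102393, indexed from 0. *)
Definition w (n : nat) : nat := if evil n then n + 1 else 0.

Lemma w_first_terms : map w (iota 0 10) = [:: 1; 0; 0; 4; 0; 6; 7; 0; 0; 10].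
Proof. by []. Qed.

(* Main.v *)
Require Import Defs.
From mathcomp Require Import all_boot.

(** For odd n, [m n] is 0 and both possible values of [w n], n + 1 and 0, are even. For n = 2k,
    doubling only appends a binary digit 0, so n is evil exactly when k is ([s2_double]); as n + 1
    is odd, [w n] has the parity of [tbar k], which is [m n]. *)

(** Digits at positions i >= k vanish because k <= i < 2 ^ i. This frees [s2] from a window length
    tied to its argument. *)
Lemma count_digits (k N : nat) :
  k <= N -> count (fun i => odd (k %/ 2 ^ i)) (iota 0 N) = s2 k.
Proof.
move=> /subnKC <-; rewrite iotaD count_cat -[RHS]addn0; congr (_ + _).
apply/eqP; rewrite -leqn0 leqNgt -has_count; apply/hasPn => i.
rewrite mem_iota add0n => /andP[le_ki _].
by rewrite divn_small // (leq_ltn_trans le_ki) // ltn_expl.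
Qed.

Lemma s2_double (k : nat) : s2 k.*2 = s2 k.
Proof.
case: k => [//|k].
(* The window of [k.+1.*2] has length [k.*2.+2]; dropping position 0 leaves [k.*2.+1] positions, the
   length to which the count for [k.+1] is widened. *)
rewrite -(count_digits k.+1 k.*2.+1); last by rewrite ltnS -addnn leq_addr.
rewrite {1}/s2 {2}doubleS -[k.*2.+2]add1n iotaD count_cat.
have -> : count (fun i => odd (k.+1.*2 %/ 2 ^ i)) (iota 0 1) = 0.
  by rewrite /= divn1 odd_double.
rewrite add0n addnC iotaDl count_map.
by apply: eq_count => i /=; rewrite add1n expnS -muln2 mulnC divnMl.
Qed.

Theorem lemma3 (n : nat) : w n = m n %[mod 2].
Proof.
rewrite -[n]odd_double_half; case: (odd n); set k := n./2.
  rewrite /m /w oddD odd_double /=; case: evil => //.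
  by rewrite !modn2 !oddD odd_double.
rewrite add0n -{2}mul2n m_even /w /tbar /evil s2_double.
by case: (odd (s2 k)); rewrite // !modn2 oddD odd_double.
Qed.
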